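(* Using the original relational adversary theorem of Aaronson (stated in the context) gives a lower bound of $\Omega(1)$ on the randomized query complexity of the matrix game.
   Context: Matrix game: let $n\in\mathbb{N}$ be a perfect square. A row matrix is a $\sqrt n\times\sqrt n$ matrix with one row of $1$s and all other entries $0$; a column matrix is a $\sqrt n\times\sqrt n$ matrix with one column of $2$s and all other entries $0$. Let $\mathcal{X}$ be the set of all $\sqrt n$ row matrices and all $\sqrt n$ column matrices, so $|\mathcal{X}|=2\sqrt n$. Given $n$ and oracle access to the entries of a matrix $F\in\mathcal{X}$ (each query reveals one entry), the goal is to correctly declare whether $F$ is a row matrix or a column matrix. The randomized query complexity is the expected number of queries required to find a solution with probability at least $9/10$ on each input, where the expectation is over the coin tosses of the protocol. Original relational adversary theorem (Aaronson): consider finite sets $A$ and $B$ and a map $\mathcal{H}:B^A\to\{0,1\}$ that labels each function $F:A\to B$ with $0$ or $1$. Let $\mathcal{A}\subseteq\mathcal{H}^{-1}(0)$ and $\mathcal{B}\subseteq\mathcal{H}^{-1}(1)$. The problem is: given $A,B,\mathcal{H},\mathcal{A},\mathcal{B}$ and oracle access to a function $F^*$ from $\mathcal{A}$ or $\mathcal{B}$ (a query $a\in A$ returns $F^*(a)$; only these queries are counted), return the label $\mathcal{H}(F^* )$. Let $r:\mathcal{A}\times\mathcal{B}\to\mathbb{R}_{\ge 0}$ be a non-zero function of our choice. For $F_1\in\mathcal{A}$, $F_2\in\mathcal{B}$, $a\in A$ define $$\theta(F_1,a)=\frac{\sum_{F_3\in\mathcal{B}:\,F_1(a)\ne F_3(a)}r(F_1,F_3)}{\sum_{F_3\in\mathcal{B}}r(F_1,F_3)},\qquad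 \theta(F_2,a)=\frac{\sum_{F_3\in\mathcal{A}:\,F_2(a)\ne F_3(a)}r(F_3,F_2)}{\sum_{F_3\in\mathcal{A}}r(F_3,F_2)}$$ whenever the denominators are all nonzero. Then the randomized query complexity of the problem is at least $1/(5\cdot v_{\min})$, where $$v_{\min}=\max_{\substack{F_1\in\mathcal{A},\,F_2\in\mathcal{B},\,a\in A:\\ r(F_1,F_2)>0,\ F_1(a)\ne F_2(a)}}\min\{\theta(F_1,a),\theta(F_2,a)\}.$$ For the matrix game, the theorem is applied with $A$ the set of $n$ matrix coordinates, $B=\{0,1,2\}$, matrices viewed as functions $A\to B$, and $\mathcal{H}$ assigning label $0$ to row matrices and $1$ to column matrices. *)

(* Defs.v *)
From HB Require Import structures.
From mathcomp Require Import all_boot all_order all_algebra.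
From mathcomp Require Import all_classical all_reals all_analysis.
Set Implicit Arguments.
Unset Strict Implicit.
Unset Printing Implicit Defensive.
Import Order.TTheory GRing.Theory Num.Theory.
Local Open Scope ring_scope.

(* A deterministic query algorithm: declare a label, or query a position and
   continue according to the value revealed there. *)
Inductive query_tree (A B : Type) : Type :=
| Declare of bool
| Query of A & (B -> query_tree A B).

Fixpoint declared (A B : Type) (t : query_tree A B) (F : A -> B) : bool :=
  match t with
  | Declare b => b
  | Query a k => declared (k (F a)) F
  end.

Fixpoint nqueries (A B : Type) (t : query_tree A B) (F : A -> B) : nat :=
  match t with
  | Declare _ => 0
  | Query a k => (nqueries (k (F a)) F).+1
  end.

(* The coin tosses range over an arbitrary probability space; fixing them turns
   the protocol into a deterministic query algorithm. *)
Record protocol (R : realType) (A B : Type) := Protocol {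
  coins_display : measure_display;
  coins : measurableType coins_display;
  coin_law : probability coins R;
  run : coins -> query_tree A B;
  measurable_declared :
    forall F : A -> B, measurable_fun setT (fun w => declared (run w) F);
  measurable_nqueries :
    forall F : A -> B, measurable_fun setT (fun w => nqueries (run w) F)
}.

Arguments run {R A B} p w : rename.

Section QueryProblem.
Variables (R : realType) (A B : finType).
(* The label 0 is [false] and the label 1 is [true]. *)
Variable H : {ffun A -> B} -> bool.

Definition success_probability (p : protocol R A B) (F : {ffun A -> B}) :
    \bar R :=
  coin_law p [set w | declared (run p w) F = H F]%classic.

Definition expected_queries (p : protocol R A B) (F : {ffun A -> B}) :
    \bar R :=
  'E_(coin_law p)[fun w => (nqueries (run p w) F)%:R]%E.

Definition solves (S : {set {ffun A -> B}}) (p : protocol R A B) : Prop :=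
  forall F, F \in S -> ((9 / 10)%:E <= success_probability p F)%E.

Definition worst_case_queries (S : {set {ffun A -> B}}) (p : protocol R A B) :
    \bar R :=
  \big[maxe/0%E]_(F in S) expected_queries p F.

Definition randomized_query_complexity (S : {set {ffun A -> B}}) : \bar R :=
  ereal_inf [set x | exists2 p, solves S p & worst_case_queries S p = x]%classic.

End QueryProblem.

Section RelationalAdversary.
Variables (R : realType) (A B : finType).
(* The function families with label 0 and with label 1, respectively. *)
Variables (S0 S1 : {set {ffun A -> B}}).
(* Only the values of [r] on S0 x S1 matter. *)
Variable r : {ffun A -> B} -> {ffun A -> B} -> R.

Definition adversary_relation : Prop :=
  (forall F1 F2, F1 \in S0 -> F2 \in S1 -> 0 <= r F1 F2) /\
  (exists F1 F2, [/\ F1 \in S0, F2 \in S1 & r F1 F2 != 0]).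

Definition nonzero_denominators : Prop :=
  (forall F1, F1 \in S0 -> \sum_(F3 in S1) r F1 F3 != 0) /\
  (forall F2, F2 \in S1 -> \sum_(F3 in S0) r F3 F2 != 0).

Definition theta0 (F1 : {ffun A -> B}) (a : A) : R :=
  (\sum_(F3 in S1 | F1 a != F3 a) r F1 F3) / \sum_(F3 in S1) r F1 F3.

Definition theta1 (F2 : {ffun A -> B}) (a : A) : R :=
  (\sum_(F3 in S0 | F2 a != F3 a) r F3 F2) / \sum_(F3 in S0) r F3 F2.

(* The base value 0 does not affect the maximum: all the terms are nonnegative,
   and the index set is nonempty if S0 and S1 are disjoint and [r] is an
   adversary relation.  The condition [0 < r F1 F2] makes the denominators of
   both ratios positive, even if some other denominators vanish. *)
Definition vmin : R :=
  \big[Num.max/0]_(F1 in S0) \big[Num.max/0]_(F2 in S1)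
    \big[Num.max/0]_(a | (0 < r F1 F2) && (F1 a != F2 a))
      Num.min (theta0 F1 a) (theta1 F2 a).

Definition relational_adversary_bound : R := 1 / (5 * vmin).

End RelationalAdversary.

Section MatrixGame.
(* [s] is the side length, so that the matrices have s ^ 2 entries. *)
Variable s : nat.

Definition row_matrix (i : 'I_s) : 'M['I_3]_s :=
  \matrix_(k, l) (if k == i then 1 else 0).

Definition column_matrix (j : 'I_s) : 'M['I_3]_s :=
  \matrix_(k, l) (if l == j then 2 else 0).

(* [mx_val] is the underlying function of a matrix. *)
Definition row_matrices : {set {ffun 'I_s * 'I_s -> 'I_3}} :=
  [set mx_val (row_matrix i) | i : 'I_s].

Definition column_matrices : {set {ffun 'I_s * 'I_s -> 'I_3}} :=
  [set mx_val (column_matrix j) | j : 'I_s].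

Definition matrix_game_inputs : {set {ffun 'I_s * 'I_s -> 'I_3}} :=
  row_matrices :|: column_matrices.

(* The values outside [matrix_game_inputs] are irrelevant. *)
Definition matrix_game_label (F : {ffun 'I_s * 'I_s -> 'I_3}) : bool :=
  F \in column_matrices.

Definition matrix_game_complexity (R : realType) : \bar R :=
  randomized_query_complexity R matrix_game_label matrix_game_inputs.

End MatrixGame.

(* Main.v *)
(* Entry (i, j) distinguishes row matrix i from every column matrix and column
   matrix j from every row matrix.  So for every relation r, a pair with
   r(F1, F2) > 0 contributes the value 1 to v_min, the largest possible, and the
   bound is exactly 1/5.

   That 1/5 is a valid lower bound needs only a special case of Aaronson's
   theorem: coin tosses that lead to no query give the same declaration on F1
   and on F2, so when the labels differ the protocol makes a query on F1
   whenever it is correct on both, which has probability at least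
   9/10 + 9/10 - 1. *)
Require Import Defs.
From HB Require Import structures.
From mathcomp Require Import all_boot all_order all_algebra.
From mathcomp Require Import all_classical all_reals all_analysis.
From mathcomp Require Import measurable_realfun lra.
Import Order.TTheory GRing.Theory Num.Theory.
Local Open Scope ring_scope.

(** The denominator may vanish: the quotient is then 0 by convention. This gives the bound on
    [theta0] without any positivity of [r]. *)
Lemma ratio_subsum_le1 (R : realType) (I : finType) (P Q : pred I)
    (f : I -> R) :
  (forall i, P i -> 0 <= f i) ->
  (\sum_(i | P i && Q i) f i) / (\sum_(i | P i) f i) <= 1.
Proof.
move=> f_ge0; have [->|nz] := eqVneq (\sum_(i | P i) f i) 0.
  by rewrite invr0 mulr0.
have s_gt0 : 0 < \sum_(i | P i) f i by rewrite lt0r nz sumr_ge0.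
rewrite ler_pdivrMr// mul1r [leRHS](bigID Q)/= lerDl.
by apply: sumr_ge0 => i /andP[/f_ge0].
Qed.

Section SeparatedFamilies.
Variables (R : realType) (A B : finType) (S0 S1 : {set {ffun A -> B}}).
Variable r : {ffun A -> B} -> {ffun A -> B} -> R.
Hypothesis r_ge0 : forall F1 F2, F1 \in S0 -> F2 \in S1 -> 0 <= r F1 F2.

Lemma theta0_le1 F1 a : F1 \in S0 -> theta0 S1 r F1 a <= 1.
Proof. by move=> F1S; apply: ratio_subsum_le1 => F3; apply: r_ge0. Qed.

Lemma vmin_le1 : vmin S0 S1 r <= 1.
Proof.
rewrite /vmin; apply: bigmax_le => // F1 F1S; apply: bigmax_le => // F2 _.
by apply: bigmax_le => // a _; rewrite ge_min theta0_le1.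
Qed.

(** The condition at [a] removes no term, so numerator and denominator are the same sum, which is
    positive because of its term [r F1 F2]. *)
Lemma theta0_eq1 F1 F2 a : F1 \in S0 -> F2 \in S1 -> 0 < r F1 F2 ->
  (forall F3, F3 \in S1 -> F1 a != F3 a) -> theta0 S1 r F1 a = 1.
Proof.
move=> F1S F2S r_gt0 sep; rewrite /theta0.
rewrite (eq_bigl (mem S1)); last first.
  by move=> F3 /=; case: (boolP (F3 \in S1)) => //= /sep ->.
apply: divff; rewrite gt_eqF// (bigD1 F2)//= ltr_wpDr// sumr_ge0// => F3.
by case/andP => F3S _; apply: r_ge0.
Qed.

Lemma theta1_eq1 F1 F2 a : F1 \in S0 -> F2 \in S1 -> 0 < r F1 F2 ->
  (forall F3, F3 \in S0 -> F2 a != F3 a) -> theta1 S0 r F2 a = 1.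
Proof.
move=> F1S F2S r_gt0 sep; rewrite /theta1.
rewrite (eq_bigl (mem S0)); last first.
  by move=> F3 /=; case: (boolP (F3 \in S0)) => //= /sep ->.
apply: divff; rewrite gt_eqF// (bigD1 F1)//= ltr_wpDr// sumr_ge0// => F3.
by case/andP => F3S _; apply: r_ge0.
Qed.

End SeparatedFamilies.

(** Separation is asked of every pair because the pair on which [r] is positive depends on [r]. *)
Lemma vmin_separated_eq1 (R : realType) (A B : finType)
    (S0 S1 : {set {ffun A -> B}}) (r : {ffun A -> B} -> {ffun A -> B} -> R) :
  adversary_relation S0 S1 r ->
  (forall F1 F2, F1 \in S0 -> F2 \in S1 -> exists a,
    (forall F3, F3 \in S1 -> F1 a != F3 a) /\
    (forall F3, F3 \in S0 -> F2 a != F3 a)) ->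
  vmin S0 S1 r = 1.
Proof.
move=> [r_ge0 [F1 [F2 [F1S F2S r_neq0]]]] /(_ _ _ F1S F2S)[a [sep0 sep1]].
have r_gt0 : 0 < r F1 F2 by rewrite lt0r r_neq0 r_ge0.
apply/eqP; rewrite eq_le vmin_le1//=.
apply: (bigmax_sup F1) => //; apply: (bigmax_sup F2) => //.
apply: (bigmax_sup a); first by rewrite r_gt0 sep0.
by rewrite (theta0_eq1 _ _ _ _ _ _ r_ge0 F1 F2)//
  (theta1_eq1 _ _ _ _ _ _ r_ge0 F1 F2)// minxx.
Qed.

(** A tree that makes no query on [F1] is a leaf, and a leaf ignores its input. *)
Lemma same_declaration_no_queries (A B : Type) (t : query_tree A B)
    (F1 F2 : A -> B) :
  nqueries t F1 = 0%N -> declared t F1 = declared t F2.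
Proof. by case: t. Qed.

(** Union bound on the complements of [X] and [Y]. *)
Lemma ge_probabilityI d (T : measurableType d) (R : realType)
    (P : probability T R) (X Y : set T) (x y : R) :
  measurable X -> measurable Y -> (x%:E <= P X)%E -> (y%:E <= P Y)%E ->
  ((x + y - 1)%:E <= P (X `&` Y)%classic)%E.
Proof.
move=> mX mY xX yY.
have mXY := measurableI _ _ mX mY.
have : (P (~` X `|` ~` Y)%classic <= P (~` X)%classic + P (~` Y)%classic)%E.
  by apply: measureU2; apply: measurableC.
rewrite -setCI !probability_setC//.
move: xX yY; rewrite -(fineK (fin_num_measure P _ mX)).
rewrite -(fineK (fin_num_measure P _ mY)) -(fineK (fin_num_measure P _ mXY)).
rewrite -!EFinB -EFinD !lee_fin; lra.
Qed.

Section QueryLowerBound.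
Variables (R : realType) (A B : finType) (H : {ffun A -> B} -> bool).
Variables (S : {set {ffun A -> B}}) (F1 F2 : {ffun A -> B}).
Hypotheses (F1S : F1 \in S) (F2S : F2 \in S) (H_neq : H F1 != H F2).

Lemma expected_queries_ge (p : protocol R A B) :
  solves H S p -> ((4 / 5)%:E <= expected_queries p F1)%E.
Proof.
move=> solp; set P := coin_law p.
pose D (F : {ffun A -> B}) := [set w | declared (run p w) F = H F]%classic.
have mD F : measurable (D F).
  rewrite -[D F]setTI.
  have /(_ measurableT [set H F]%classic) := @measurable_declared _ _ _ p F.
  exact.
have mX : measurable_fun setT
    (fun w => ((nqueries (run p w) F1)%:R : R)%:E).
  apply/measurable_EFinP.
  have mR : measurable_fun setT (fun n : nat => n%:R : R) by [].
  exact: measurableT_comp mR (@measurable_nqueries _ _ _ p F1).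
have X_ge1 w : (D F1 `&` D F2)%classic w ->
    (1 <= ((nqueries (run p w) F1)%:R : R)%:E)%E.
  move=> [D1 D2]; rewrite lee_fin ler1n lt0n; apply/eqP => n0.
  move: H_neq; rewrite -D1 -D2 (same_declaration_no_queries _ _ _ F1 F2 n0).
  by rewrite eqxx.
rewrite /expected_queries unlock.
have le45 : ((4 / 5)%:E <= P (D F1 `&` D F2)%classic)%E.
  have := ge_probabilityI _ _ _ P _ _ _ _ (mD F1) (mD F2) (solp _ F1S)
    (solp _ F2S).
  by apply: le_trans; rewrite lee_fin; lra.
apply: (le_trans le45).
(* The probability becomes the integral of 1 over the event that both inputs are answered correctly.
   There the query count is at least 1, and being nonnegative it can then be integrated over the
   whole space. *)
rewrite -[leLHS]mul1e -integral_cst//; last exact: measurableI.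
apply: (@le_trans _ _ (\int[P]_(w in (D F1 `&` D F2)%classic)
   ((nqueries (run p w) F1)%:R : R)%:E)%E).
  apply: ge0_le_integral => //; first exact: measurableI.
  exact: measurable_funS mX.
apply: ge0_subset_integral => //; first exact: measurableI.
Qed.

Lemma randomized_query_complexity_ge :
  ((4 / 5)%:E <= randomized_query_complexity R H S)%E.
Proof.
apply/ereal_infP => _ [p solp <-].
by apply: (bigmax_sup F1) => //; apply: expected_queries_ge.
Qed.

End QueryLowerBound.

Section MatrixGame.
Variable s : nat.

(** On row [i] the row matrix shows 1, a column matrix only 0 or 2; on column [j] the column matrix
    shows 2, a row matrix only 0 or 1. *)
Lemma row_column_separated (i j k : 'I_s) :
  mx_val (row_matrix i) (i, k) != mx_val (column_matrix j) (i, k) /\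
  mx_val (column_matrix j) (k, j) != mx_val (row_matrix i) (k, j).
Proof.
have mx_valE (M : 'M['I_3]_s) a b : mx_val M (a, b) = M a b by [].
by rewrite !mx_valE !mxE !eqxx; case: (k == i); case: (k == j).
Qed.

Lemma matrix_game_separated F1 F2 :
  F1 \in row_matrices s -> F2 \in column_matrices s -> exists a,
    (forall F3, F3 \in column_matrices s -> F1 a != F3 a) /\
    (forall F3, F3 \in row_matrices s -> F2 a != F3 a).
Proof.
move=> /imsetP[i _ ->] /imsetP[j _ ->]; exists (i, j).
split=> _ /imsetP[k _ ->].
  by have [] := row_column_separated i k j.
by have [] := row_column_separated k j i.
Qed.

End MatrixGame.

Theorem lemma5 (R : realType) :
  exists c C : R, 0 < c /\
    forall n s : nat, (0 < n)%N -> n = (s ^ 2)%N ->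
      (exists r : {ffun 'I_s * 'I_s -> 'I_3} -> {ffun 'I_s * 'I_s -> 'I_3} -> R,
        [/\ adversary_relation (row_matrices s) (column_matrices s) r,
            nonzero_denominators (row_matrices s) (column_matrices s) r,
            c <= relational_adversary_bound
                   (row_matrices s) (column_matrices s) r
          & ((relational_adversary_bound
                (row_matrices s) (column_matrices s) r)%:E
              <= matrix_game_complexity s R)%E]) /\
      (forall r : {ffun 'I_s * 'I_s -> 'I_3} -> {ffun 'I_s * 'I_s -> 'I_3} -> R,
        adversary_relation (row_matrices s) (column_matrices s) r ->
        relational_adversary_bound (row_matrices s) (column_matrices s) r <= C).
Proof.
exists (1 / 5), (1 / 5); split; first by lra.
move=> n s n_gt0 ns.
have boundE r : adversary_relation (row_matrices s) (column_matrices s) r ->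
    relational_adversary_bound (row_matrices s) (column_matrices s) r
    = 1 / 5 :> R.
  move=> rel; rewrite /relational_adversary_bound vmin_separated_eq1 ?mulr1//.
  exact: matrix_game_separated.
split; last by move=> r /boundE ->.
have s_gt0 : (0 < s)%N by move: n_gt0; rewrite ns expn_gt0 orbF.
pose i0 := Ordinal s_gt0.
pose F1 := mx_val (row_matrix i0); pose F2 := mx_val (column_matrix i0).
have F1S : F1 \in row_matrices s by apply: imset_f.
have F2S : F2 \in column_matrices s by apply: imset_f.
(* The constant relation 1 turns the denominators into cardinalities of nonempty sets. *)
have rel : adversary_relation (row_matrices s) (column_matrices s)
    (fun _ _ => 1 : R).
  by split=> [//|]; exists F1, F2; split=> //; apply: oner_neq0.
have card_neq0 (T : finType) (S : {set T}) x :
    x \in S -> \sum_(y in S) (1 : R) != 0.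
  by move=> xS; rewrite sumr_const pnatr_eq0 -lt0n; apply/card_gt0P; exists x.
exists (fun _ _ => 1); split=> //.
- by split=> F _; [apply: card_neq0 F2S | apply: card_neq0 F1S].
- by rewrite boundE.
- rewrite boundE//; apply: (@le_trans _ _ (4 / 5)%:E).
    by rewrite lee_fin; lra.
  apply: (randomized_query_complexity_ge _ _ _ _ _ F1 F2).
  + by rewrite inE F1S.
  + by rewrite inE F2S orbT.
  + rewrite /matrix_game_label F2S.
    (* Were [F1] also a column matrix, separation would make it differ from itself at [a]; hence the
       labels differ. *)
    have [a [sep _]] := matrix_game_separated _ _ _ F1S F2S.
    by have [/sep|//] := boolP (F1 \in column_matrices s); rewrite eqxx.
Qed.
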